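(* For every integer $n\ge 3$ with $n\ne 5$, $f(n,C_3)=2^{n-2}$. Additionally, $f(5,C_3)=7$.
   Context: $[n]=\{1,\dots,n\}$ and $\mathcal{P}(n)$ is the set of all subsets of $[n]$. For a graph $G$, a hypergraph $H$ is called Berge-$G$ if there is a copy of $G$ with $V(G)\subseteq V(H)$ and a bijection $g:E(G)\to E(H)$ such that $e\subseteq g(e)$ for every $e\in E(G)$. A family of subsets of $[n]$ (viewed as a hypergraph with vertex set $[n]$) is $G$-free if it contains no subfamily that is a Berge-$G$ hypergraph. $f(n,G)$ denotes the smallest number of colors in a coloring (partition) of $\mathcal{P}(n)$ such that every color class is $G$-free. $C_3$ is the triangle; a Berge-$C_3$ consists of three different subsets $A,B,C\subseteq[n]$ such that $A\cap B$, $A\cap C$, $B\cap C$ have distinct representatives. *)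

(* Defs.v *)
From mathcomp Require Import all_boot.
Set Implicit Arguments. Unset Strict Implicit. Unset Printing Implicit Defensive.

Record sgraph := SGraph {
  vertex :> finType;
  adj : rel vertex;
  adj_sym : symmetric adj;
  adj_irr : irreflexive adj
}.

Definition edges (G : sgraph) : {set {set G}} :=
  [set [set p.1; p.2] | p : G * G & adj p.1 p.2].

Lemma neq_sym (T : eqType) : symmetric [rel x y : T | x != y].
Proof. by move=> x y /=; rewrite eq_sym. Qed.

Lemma neq_irr (T : eqType) : irreflexive [rel x y : T | x != y].
Proof. by move=> x /=; rewrite eqxx. Qed.

Definition C3 : sgraph := SGraph (@neq_sym 'I_3) (@neq_irr 'I_3).

(* The set [n] is rendered by 'I_n, and a hypergraph with vertex set [n] by
   its set of hyperedges.  The map phi is the copy of G inside [n]; only the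
   values of g on edges G matter, where it is a bijection onto E. *)
Definition Berge (n : nat) (G : sgraph) (E : {set {set 'I_n}}) : Prop :=
  exists (phi : G -> 'I_n) (g : {set G} -> {set 'I_n}),
    [/\ injective phi,
        {in edges G &, injective g},
        g @: edges G = E
      & forall e : {set G}, e \in edges G -> phi @: e \subset g e].

Definition Berge_free (n : nat) (G : sgraph) (F : {set {set 'I_n}}) : Prop :=
  forall E : {set {set 'I_n}}, E \subset F -> ~ Berge G E.

Definition colorable (n : nat) (G : sgraph) (k : nat) : Prop :=
  exists c : {set 'I_n} -> 'I_k,
    forall i : 'I_k, Berge_free G [set A | c A == i].

(* f(n, G) = k.  A relation rather than a function, because no coloring exists
   at all for some G (e.g. a single edge, when n >= 2).  Color classes may be
   empty, which does not affect the minimum. *)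
Definition f_is (n : nat) (G : sgraph) (k : nat) : Prop :=
  colorable n G k /\ forall j : nat, colorable n G j -> k <= j.

(* Main.v *)
Require Import Defs.
From mathcomp Require Import all_boot zify.

Set Implicit Arguments. Unset Strict Implicit. Unset Printing Implicit Defensive.

(** Three distinct sets [A], [B], [C] form a Berge triangle exactly when
    [A :&: B], [A :&: C] and [B :&: C] have distinct representatives.  These
    three intersections pairwise meet in [A :&: B :&: C], so Hall's condition
    becomes very simple ([sdr]): the number of common points, plus the number
    of pairs that share a point outside the third set, is at least 3.

    Upper bound.  The sets [A], [~: A], [B], [~: B] never contain a Berge
    triangle, because any three of them include two disjoint ones.  Hence any
    partition of the power set into such quadruples is a good coloring with
    2^(n-2) colors ([colorable_pow2]).  For n = 5 one can do better with two
    classes containing three 3-sets through a common pair, and an explicit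
    partition into 7 classes is verified by computation ([colorable5]).

    Lower bound.  If every Berge-C3-free family has weight at most W, then k
    colors require the total weight to be at most k * W ([weight_bound]).  Give
    a set weight 2, 1 or 0 according to whether its size is more than, equal to
    or less than n/2: complementary sets have weights adding up to 2, so the
    total is 2^n, and it suffices that a free family has weight at most 4
    ([half_weight_le4], for n >= 7).  Three large sets always form a Berge
    triangle, which settles odd n.  For n = 2k >= 8, so do two large sets and a
    k-set.  Fix a point i: three k-sets missing i form a triangle, and a large
    set A with two k-sets missing i forms one unless one of the k-sets is
    [A :\ i].  So a free family has at most two k-sets missing any given i, and
    in the presence of A at most one, apart from the points i for which
    [A :\ i] is in the family.  Counting the pairs (k-set, missed point), of
    which each k-set contributes k, bounds the number of k-sets by 4, and by 2
    in the presence of a large set.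

    For n <= 6 the maximal weight of a free family is computed by an exhaustive
    search proved correct ([search_sound]).  For n = 3 and n = 6 the same
    weights do; for n = 4 and n = 5 there are free families of weight above 4,
    and other weights give the exact values. *)

(** * Berge triangles and distinct representatives *)

(** Hall's condition for the three pairwise intersections: a representative is
    either common to all three sets or private to one pair, and privates of
    different pairs are automatically distinct. *)
Definition sdr (T : finType) (A B C : {set T}) : bool :=
  2 < #|A :&: B :&: C| + (0 < #|A :&: B :\: C|)
      + (0 < #|A :&: C :\: B|) + (0 < #|B :&: C :\: A|).

Lemma sdrP (T : finType) (A B C : {set T}) :
  reflect (exists x y z, [/\ uniq [:: x; y; z], x \in A :&: B, y \in A :&: C
                          & z \in B :&: C])
          (sdr A B C).
Proof.
rewrite /sdr; set D := A :&: B :&: C; set P := A :&: B :\: C.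
set Q := A :&: C :\: B; set R := B :&: C :\: A.
apply: (iffP idP); last first.
  case=> x [y [z [u xAB yAC zBC]]].
  (* Representatives of the three pairs lie in the common part, except at most
     one in each nonempty private part. *)
  pose one (S : {set T}) t := if t \in S then [set t] else set0.
  have bnd S t : #|one S t| <= (0 < #|S|).
    rewrite /one; case: ifP => [tS|_]; last by rewrite cards0.
    by rewrite cards1 (cardD1 t) tS.
  have sub : [:: x; y; z] \subset D :|: one P x :|: one Q y :|: one R z.
    move: xAB yAC zBC; rewrite !inE => /andP[xA xB] /andP[yA yC] /andP[zB zC].
    apply/subsetP => t; rewrite !inE => /or3P [] /eqP ->;
      rewrite /one !inE ?xA ?xB ?yA ?yC ?zB ?zC /=.
    - by case: (x \in C); rewrite //= inE eqxx.
    - by case: (y \in B); rewrite //= !inE eqxx !orbT.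
    - by case: (z \in A); rewrite //= !inE eqxx !orbT.
  have := subset_leq_card sub; move/card_uniqP: u => ->.
  have [h1 _] := leq_card_setU (D :|: one P x :|: one Q y) (one R z).
  have [h2 _] := leq_card_setU (D :|: one P x) (one Q y).
  have [h3 _] := leq_card_setU D (one P x).
  have := bnd P x; have := bnd Q y; have := bnd R z.
  rewrite /=; lia.
have inD t : t \in D -> [/\ t \in A, t \in B & t \in C].
  by rewrite !inE -andbA => /and3P.
have inP t : t \in P -> [/\ t \in A, t \in B & (t \in C) = false].
  by rewrite !inE => /andP[/negPf-> /andP[]].
have inQ t : t \in Q -> [/\ t \in A, (t \in B) = false & t \in C].
  by rewrite !inE => /andP[/negPf-> /andP[]].
have inR t : t \in R -> [/\ (t \in A) = false, t \in B & t \in C].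
  by rewrite !inE => /andP[/negPf-> /andP[]].
(* Conversely, take a private point wherever there is one and fill up with
   common points. *)
have pick3 x y z : x \in D :|: P -> y \in D :|: Q -> z \in D :|: R ->
    x != y -> x != z -> y != z ->
    exists x y z, [/\ uniq [:: x; y; z], x \in A :&: B, y \in A :&: C
                    & z \in B :&: C].
  move=> xP yQ zR xy xz yz; exists x, y, z.
  rewrite /= !inE negb_or xy xz yz; split=> //; rewrite ?inE.
  - by case/setUP: xP => [/inD|/inP] [-> ->].
  - by case/setUP: yQ => [/inD|/inQ] [-> ? ->].
  - by case/setUP: zR => [/inD|/inR] [? -> ->].
have DP d p : d \in D -> p \in P -> d != p.
  by move=> /inD [_ _ d1] /inP [_ _ p0]; apply: contraTneq d1 => ->; rewrite p0.
have DQ d q : d \in D -> q \in Q -> d != q.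
  by move=> /inD [_ d1 _] /inQ [_ q0 _]; apply: contraTneq d1 => ->; rewrite q0.
have DR d r : d \in D -> r \in R -> d != r.
  by move=> /inD [d1 _ _] /inR [r0 _ _]; apply: contraTneq d1 => ->; rewrite r0.
have PQ p q : p \in P -> q \in Q -> p != q.
  by move=> /inP [_ p1 _] /inQ [_ q0 _]; apply: contraTneq p1 => ->; rewrite q0.
have PR p r : p \in P -> r \in R -> p != r.
  by move=> /inP [p1 _ _] /inR [r0 _ _]; apply: contraTneq p1 => ->; rewrite r0.
have QR q r : q \in Q -> r \in R -> q != r.
  by move=> /inQ [q1 _ _] /inR [r0 _ _]; apply: contraTneq q1 => ->; rewrite r0.
have one : 0 < #|D| -> exists d, d \in D by move=> /card_gt0P.
have two : 1 < #|D| -> exists d e, [/\ d \in D, e \in D & d != e] by move=> /card_gt1P.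
case: (posnP #|P|) => [_|/card_gt0P [p pP]];
  case: (posnP #|Q|) => [_|/card_gt0P [q qQ]];
  case: (posnP #|R|) => [_|/card_gt0P [r rR]];
  rewrite ?addn0 ?addn1 ?ltnS => h.
- have [x [y [z [[xD yD zD] [xy yz zx]]]]] := card_gt2P h.
  by apply: (pick3 x y z); rewrite // ?in_setU ?xD ?yD ?zD // eq_sym.
- have [d [e [dD eD de]]] := two h.
  by apply: (pick3 d e r); rewrite ?(in_setU, dD, eD, rR, orbT) // DR.
- have [d [e [dD eD de]]] := two h.
  by apply: (pick3 d q e); rewrite ?(in_setU, dD, eD, qQ, orbT) // ?(DQ d q) // eq_sym (DQ e q).
- have [d dD] := one h.
  by apply: (pick3 d q r); rewrite ?(in_setU, dD, qQ, rR, orbT) // ?(DQ d q, DR d r, QR q r).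
- have [d [e [dD eD de]]] := two h.
  by apply: (pick3 p d e); rewrite ?(in_setU, dD, eD, pP, orbT) // eq_sym (DP d p, DP e p).
- have [d dD] := one h.
  by apply: (pick3 p d r); rewrite ?(in_setU, dD, pP, rR, orbT) // ?(DR d r, PR p r) //
    eq_sym (DP d p).
- have [d dD] := one h.
  by apply: (pick3 p q d); rewrite ?(in_setU, dD, pP, qQ, orbT) // ?(PQ p q) //
    eq_sym (DP d p, DQ d q).
- by apply: (pick3 p q r); rewrite ?(in_setU, pP, qQ, rR, orbT) // ?(PQ p q, PR p r, QR q r).
Qed.

Lemma edges_C3 (e : {set C3}) : (e \in edges C3) = (#|e| == 2).
Proof.
apply/imsetP/cards2P => [[[i j] ij ->]|[i [j [ij ->]]]].
  by exists i, j; move: ij; rewrite inE.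
by exists (i, j); rewrite ?inE.
Qed.

(** The vertex of the triangle on two edges must be sent into the intersection
    of the two hyperedges, so a copy of C3 is a choice of distinct
    representatives. *)
Lemma Berge_free_C3P (n : nat) (F : {set {set 'I_n}}) :
  Berge_free C3 F <->
  (forall A B C, A \in F -> B \in F -> C \in F -> uniq [:: A; B; C] ->
     ~~ sdr A B C).
Proof.
pose a : C3 := inord 0 : 'I_3; pose b : C3 := inord 1 : 'I_3.
pose c : C3 := inord 2 : 'I_3.
have ordE (i : C3) : [\/ i = a, i = b | i = c].
  by case: i => [[|[|[|//]]] lti]; [constructor 1|constructor 2|constructor 3];
     apply/val_inj; rewrite /= inordK.
have ab : (a == b) = false by rewrite -val_eqE /= !inordK.
have ac : (a == c) = false by rewrite -val_eqE /= !inordK.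
have bc : (b == c) = false by rewrite -val_eqE /= !inordK.
have ba : (b == a) = false by rewrite eq_sym.
have ca : (c == a) = false by rewrite eq_sym.
have cb : (c == b) = false by rewrite eq_sym.
have [eab eac ebc] : [/\ [set a; b] \in edges C3, [set a; c] \in edges C3
                        & [set b; c] \in edges C3].
  by rewrite !edges_C3 !cards2 ab ac bc.
have edgeE (e : {set C3}) : e \in edges C3 ->
    [\/ e = [set a; b], e = [set a; c] | e = [set b; c]].
  rewrite edges_C3 => /cards2P [i [j [ij ->]]].
  case: (ordE i) (ordE j) ij => -> [] ->; rewrite ?eqxx //= => _;
  by [constructor 1|constructor 2|constructor 3
     |constructor 1; rewrite setUC|constructor 2; rewrite setUC
     |constructor 3; rewrite setUC].
split=> [free A B C AF BF CF uABC|free E EF [phi [g [phi_inj g_inj gE phig]]]].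
  apply/sdrP => -[x [y [z [uxyz xAB yAC zBC]]]].
  (* The edges ab, ac, bc go to A, B, C, and each vertex to the representative
     chosen for its two edges. *)
  pose phi (i : C3) := if i == a then x else if i == b then y else z.
  pose g (e : {set C3}) := if c \notin e then A else if b \notin e then B else C.
  have gab : g [set a; b] = A by rewrite /g !inE ca cb.
  have gac : g [set a; c] = B by rewrite /g !inE eqxx ba bc orbT.
  have gbc : g [set b; c] = C by rewrite /g !inE !eqxx orbT.
  have [pa pb pc] : [/\ phi a = x, phi b = y & phi c = z].
    by rewrite /phi !eqxx ba ca cb.
  have memP (S : {set 'I_n}) i j : phi i \in S -> phi j \in S -> phi @: [set i; j] \subset S.
    by move=> iS jS; apply/subsetP => t /imsetP [k /set2P [] -> ->].
  apply: (free (g @: edges C3)).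
    apply/subsetP => S /imsetP [e _ ->]; rewrite /g.
    by case: ifP => // _; case: ifP.
  move: uxyz uABC; rewrite /= !inE !negb_or !andbT.
  case/andP=> /andP[/eqP xy /eqP xz] /eqP yz /andP[/andP[/eqP AB /eqP AC] /eqP BC].
  exists phi, g; split=> //.
  - by move=> i j; case: (ordE i) (ordE j) => -> [] ->; rewrite ?pa ?pb ?pc //; congruence.
  - by move=> d e /edgeE [] -> /edgeE [] ->; rewrite ?gab ?gac ?gbc //; congruence.
  - move: xAB yAC zBC => /setIP[xA xB] /setIP[yA yC] /setIP[zB zC].
    by move=> e /edgeE [] ->; rewrite ?gab ?gac ?gbc memP ?pa ?pb ?pc.
have gF e : e \in edges C3 -> g e \in F.
  by move=> ee; apply: (subsetP EF); rewrite -gE imset_f.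
have phiE i j : [set i; j] \in edges C3 ->
    phi i \in g [set i; j] /\ phi j \in g [set i; j].
  by move=> ij; have /subsetP sub := phig _ ij; split; apply: sub;
    rewrite imset_f // !inE eqxx ?orbT.
have [[aA bA] [[aB cB] [bC cC]]] := conj (phiE _ _ eab) (conj (phiE _ _ eac) (phiE _ _ ebc)).
have uABC : uniq [:: g [set a; b]; g [set a; c]; g [set b; c]].
  rewrite /= !inE !(inj_in_eq g_inj) // negb_or andbT -!andbA.
  apply/and3P; split; apply/eqP => /setP.
  - by move/(_ b); rewrite !inE eqxx ba bc orbT.
  - by move/(_ a); rewrite !inE eqxx ab ac.
  - by move/(_ a); rewrite !inE eqxx ab ac.
have /sdrP[] := free _ _ _ (gF _ eab) (gF _ eac) (gF _ ebc) uABC.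
exists (phi a), (phi b), (phi c).
by rewrite /= !inE !(inj_eq phi_inj) ab ac bc aA bA aB cB bC cC.
Qed.

(** * The coloring with 2^(n-2) colors *)

(** Two sets get the same color when they are equal or complementary away from
    the point [i0], that is, when they cut the remaining points in the same two
    parts.  A class is thus determined by the points other than [i0], [i1] that
    are not on the side of [i1], and it consists of two complementary pairs. *)
Lemma colorable_pow2 (n : nat) : 2 <= n -> colorable n C3 (2 ^ (n - 2)).
Proof.
case: n => [|[|m]] // _; rewrite subn2 /=.
pose i0 : 'I_m.+2 := ord0; pose i1 : 'I_m.+2 := lift ord0 ord0.
pose sh (j : 'I_m) : 'I_m.+2 := lift ord0 (lift ord0 j).
pose T (A : {set 'I_m.+2}) := [set j | (sh j \in A) != (i1 \in A)].
have cT : #|{set 'I_m}| = 2 ^ m.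
  by rewrite -cardsT -powersetT card_powerset cardsT card_ord.
exists (fun A => cast_ord cT (enum_rank (T A))) => k.
apply/Berge_free_C3P => A B C; rewrite !inE => /eqP cA /eqP cB /eqP cC uABC.
have TE (X Y : {set 'I_m.+2}) : cast_ord cT (enum_rank (T X)) = k ->
    cast_ord cT (enum_rank (T Y)) = k -> forall j, (sh j \in X) (+) (i1 \in X) =
    (sh j \in Y) (+) (i1 \in Y).
  move=> <- /cast_ord_inj/enum_rank_inj/setP XY j.
  by have := XY j; rewrite !inE; do 4!case: (_ \in _).
have ordE (i : 'I_m.+2) : [\/ i = i0, i = i1 | exists j, i = sh j].
  case: (unliftP ord0 i) => [i' ->|->]; last by constructor 1.
  by case: (unliftP ord0 i') => [j ->|->]; [constructor 3; exists j|constructor 2].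
have same (X Y : {set 'I_m.+2}) : (i0 \in X) = (i0 \in Y) -> (i1 \in X) = (i1 \in Y) ->
    cast_ord cT (enum_rank (T X)) = k -> cast_ord cT (enum_rank (T Y)) = k -> X = Y.
  move=> e0 e1 cX cY; apply/setP => i; case: (ordE i) => [->|->|[j ->]] //.
  by have := TE _ _ cX cY j; rewrite e1 => /addIb.
have opp (X Y : {set 'I_m.+2}) : (i0 \in X) = ~~ (i0 \in Y) -> (i1 \in X) = ~~ (i1 \in Y) ->
    cast_ord cT (enum_rank (T X)) = k -> cast_ord cT (enum_rank (T Y)) = k ->
    forall i, i \in X :&: Y -> False.
  move=> e0 e1 cX cY i; rewrite inE; apply/negP.
  case: (ordE i) => [->|->|[j ->]]; rewrite ?e0 ?e1 ?andNb //.
  by have := TE _ _ cX cY j; rewrite e1; do 3!case: (_ \in _).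
apply/sdrP => -[x [y [z [_ xAB yAC zBC]]]]; move: uABC.
rewrite /= !inE negb_or andbT => /andP[/andP[/eqP AB /eqP AC] /eqP BC].
(* The traces on [i0], [i1] are three of the four possible ones, and these
   include two opposite ones. *)
have := same A B; have := opp A B; have := same A C; have := opp A C.
have := same B C; have := opp B C.
by case: (i0 \in A) (i0 \in B) (i0 \in C) => [] [] [];
  case: (i1 \in A) (i1 \in B) (i1 \in C) => [] [] [] /=; eauto.
Qed.

(** * Lower bounds from weights *)

Lemma weight_bound (n k W : nat) (w : {set 'I_n} -> nat) :
  (forall F : {set {set 'I_n}}, Berge_free C3 F -> \sum_(A in F) w A <= W) ->
  colorable n C3 k -> \sum_A w A <= k * W.
Proof.
move=> wF [c cP]; rewrite (partition_big c predT) //=.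
rewrite -[k in k * W]card_ord -sum_nat_const; apply: leq_sum => i _.
by rewrite (leq_trans _ (wF _ (cP i))) // leq_eqVlt; apply/orP; left;
   apply/eqP/eq_bigl => A; rewrite inE.
Qed.

Definition half_weight (n : nat) (A : {set 'I_n}) : nat :=
  (n < 2 * #|A|) + (n <= 2 * #|A|).

Lemma half_weightC (n : nat) (A : {set 'I_n}) :
  half_weight A + half_weight (~: A) = 2.
Proof.
rewrite /half_weight; have := cardsC A; rewrite card_ord.
move: #|A| #|~: A| => a b ab.
by do 2!case: leqP => ?; do 2!case: leqP => ? /=; lia.
Qed.

Lemma sum_half_weight (n : nat) : \sum_(A : {set 'I_n}) half_weight A = 2 ^ n.
Proof.
apply/eqP; rewrite -(eqn_pmul2r (isT : 0 < 2)) muln2 -addnn.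
rewrite [X in _ + X](reindex_inj (@setC_inj _)) -big_split /=; apply/eqP.
rewrite (eq_bigr (fun=> 2)) => [|A _]; last exact: half_weightC.
by rewrite sum_nat_const -cardsT -powersetT card_powerset cardsT card_ord.
Qed.

(** * Free families have half-weight at most 4 when n >= 7 *)

(** All cardinalities of the Venn diagram in terms of its regions; this turns
    the existence of Berge triangles into linear arithmetic.  The numbers [a],
    [b], [c] are the sizes of the regions covered by a single set. *)
Lemma venn3 (T : finType) (A B C : {set T}) :
  let d := #|A :&: B :&: C| in let p := #|A :&: B :\: C| in
  let q := #|A :&: C :\: B| in let r := #|B :&: C :\: A| in
  exists a b c,
    [/\ [/\ #|A| = a + p + q + d, #|B| = b + p + r + d & #|C| = c + q + r + d],
        [/\ #|A :\: B| = a + q, #|A :\: C| = a + p & #|B :\: C| = b + p],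
        [/\ #|B :\: A| = b + r, #|C :\: A| = c + r & #|C :\: B| = c + q]
      & #|B :|: C| = b + c + p + q + r + d /\
        #|A :|: B :|: C| = a + b + c + p + q + r + d].
Proof.
have cardE (S : {set T}) : #|S| = \sum_x (x \in S).
  by rewrite -sum1_card big_mkcond.
exists #|A :\: B :\: C|, #|B :\: A :\: C|, #|C :\: A :\: B|.
rewrite !cardE -!big_split /=.
by do !split; apply: eq_bigr => x _; rewrite !inE;
   case: (x \in A); case: (x \in B); case: (x \in C).
Qed.

Lemma setD_neq (T : finType) (A B : {set T}) :
  A != B -> 0 < #|A :\: B| + #|B :\: A|.
Proof. by rewrite addn_gt0 !card_gt0 -negb_and !setD_eq0 -eqEsubset. Qed.

Lemma sdrPn (T : finType) (A B C : {set T}) : ~~ sdr A B C ->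
  let d := #|A :&: B :&: C| in let p := #|A :&: B :\: C| in
  let q := #|A :&: C :\: B| in let r := #|B :&: C :\: A| in
  d = 0 /\ (p = 0 \/ q = 0 \/ r = 0) \/
  d = 1 /\ (p = 0 /\ q = 0 \/ p = 0 /\ r = 0 \/ q = 0 /\ r = 0) \/
  d = 2 /\ p = 0 /\ q = 0 /\ r = 0.
Proof.
rewrite /sdr; move: #|A :&: B :&: C| #|_ :\: C| #|_ :\: B| #|_ :\: A| => d p q r.
by case: d p q r => [|[|[|d]]] [|p] [|q] [|r] //= _; lia.
Qed.

(** With n points the points covered at least twice number at least 3, and two
    of the sets can meet the third in one and the same point only if both are
    its complement plus that point. *)
Lemma sdr_large (T : finType) (A B C : {set T}) : 6 <= #|T| ->
  #|T| < 2 * #|A| -> #|T| < 2 * #|B| -> #|T| <= 2 * #|C| -> uniq [:: A; B; C] -> sdr A B C.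
Proof.
move=> n6 lA lB lC; rewrite /= !inE negb_or andbT => /andP[/andP[AB AC] BC].
apply/negPn/negP => /sdrPn.
have := max_card (A :|: B :|: C).
move: (setD_neq AB) (setD_neq AC) (setD_neq BC) => {AB AC BC}.
have [a [b [c [[? ? ?] [? ? ?] [? ? ?] [? ?]]]]] := venn3 A B C.
lia.
Qed.

Lemma card_notin (T : finType) (i : T) (A : {set T}) : i \notin A -> #|A| < #|T|.
Proof. by move=> iA; have := max_card (i |: A); rewrite cardsU1 iA. Qed.

(** Missing a point brings the situation back to sets larger than half of the
    ground set.  The condition n >= 8 excludes three 3-sets on 5 points with a
    common pair. *)
Lemma sdr_middle (T : finType) (i : T) (A B C : {set T}) : 8 <= #|T| ->
  2 * #|A| = #|T| -> 2 * #|B| = #|T| -> 2 * #|C| = #|T| ->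
  i \notin A :|: B :|: C -> uniq [:: A; B; C] -> sdr A B C.
Proof.
move=> n8 lA lB lC iN; rewrite /= !inE negb_or andbT => /andP[/andP[AB AC] BC].
apply/negPn/negP => /sdrPn.
have := card_notin iN.
move: (setD_neq AB) (setD_neq AC) (setD_neq BC) => {AB AC BC}.
have [a [b [c [[? ? ?] [? ? ?] [? ? ?] [? ?]]]]] := venn3 A B C.
lia.
Qed.

(** The only obstruction is two k-sets meeting in one point [x], with [A] equal
    to one of them plus [i]: then [x] would have to represent two pairs. *)
Lemma sdr_mixed (T : finType) (i : T) (A X Y : {set T}) : 8 <= #|T| ->
  #|T| < 2 * #|A| -> 2 * #|X| = #|T| -> 2 * #|Y| = #|T| ->
  i \notin X :|: Y -> X != Y -> ~~ sdr A X Y ->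
  i \in A /\ (A :\ i = X \/ A :\ i = Y).
Proof.
move=> n8 lA lX lY iN XY /sdrPn ns.
have := card_notin iN; move: (setD_neq XY) (max_card (A :|: X :|: Y)) => {}XY cU cXY.
have iXY : i \notin X /\ i \notin Y by move: iN; rewrite inE negb_or => /andP[].
have [a [b [c [[? ? ?] [? ? ?] [? ? ?] [? ?]]]]] := venn3 A X Y.
have iA : i \in A.
  apply/negPn/negP => iA; have : i \notin A :|: X :|: Y.
    by rewrite -setUA inE negb_or iA.
  by move/card_notin; lia.
(* [A] contains one of the two sets and has at most one more element, so this
   element is [i]. *)
have del (Z : {set T}) : i \notin Z -> #|Z :\: A| = 0 -> #|A| <= #|Z|.+1 -> A :\ i = Z.
  move=> iZ /cards0_eq/eqP; rewrite setD_eq0 => ZA; rewrite (cardsD1 i A) iA => AZ.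
  by apply/esym/eqP; rewrite eqEcard subsetD1 ZA iZ.
split=> //.
suff : #|X :\: A| = 0 /\ #|A| <= #|X|.+1 \/ #|Y :\: A| = 0 /\ #|A| <= #|Y|.+1.
  by case: iXY => iX iY [] [? ?]; [left|right]; apply: del.
lia.
Qed.

(** The sets of size exactly n/2 are bounded by double counting the pairs
    formed by such a set and a point that it misses. *)
Lemma half_weight_le4 (n : nat) (F : {set {set 'I_n}}) : 7 <= n ->
  Berge_free C3 F -> \sum_(A in F) half_weight A <= 4.
Proof.
move=> n7 /Berge_free_C3P free.
pose big := [set A in F | n < 2 * #|A|]; pose mid := [set A in F | 2 * #|A| == n].
have bigP A : A \in big -> A \in F /\ n < 2 * #|A| by rewrite inE => /andP[].
have midP A : A \in mid -> A \in F /\ 2 * #|A| = n by rewrite inE => /andP[? /eqP].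
have bm A X : A \in big -> X \in mid -> A != X.
  by move=> /bigP[_ lA] /midP[_ lX]; apply: contraTneq lA => ->; rewrite lX ltnn.
have cardI (G : {set {set 'I_n}}) (P : pred {set 'I_n}) :
    #|[set A in G | P A]| = \sum_(A in G) P A.
  by rewrite -sum1dep_card big_mkcondr /=; apply: eq_bigr => A _; case: (P A).
have -> : \sum_(A in F) half_weight A = 2 * #|big| + #|mid|.
  rewrite !cardI big_distrr -big_split /=; apply: eq_bigr => A _.
  by rewrite /half_weight; case: ltngtP.
have big2 : #|big| <= 2.
  rewrite leqNgt; apply/negP => /card_gt2P [A [B [C [[bA bB bC] [AB BC CA]]]]].
  move: (bigP _ bA) (bigP _ bB) (bigP _ bC) => [FA lA] [FB lB] [FC lC].
  have u : uniq [:: A; B; C] by rewrite /= !inE negb_or AB BC eq_sym CA.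
  by apply: (negP (free _ _ _ FA FB FC u)); apply: sdr_large; rewrite ?card_ord // ltnW.
have [mid0|/card_gt0P [X0 mX0]] := posnP #|mid|; first by lia.
(* From here on there is a set of size exactly n/2, so n is even. *)
have [k n2k] : exists k, n = 2 * k by case: (midP _ mX0) => _ <-; exists #|X0|.
have [k4 n8] : 4 <= k /\ 8 <= n by clear -n7 n2k; lia.
have big1 : #|big| <= 1.
  rewrite leqNgt; apply/negP => /card_gt1P [A [B [bA bB AB]]].
  move: (bigP _ bA) (bigP _ bB) (midP _ mX0) => [FA lA] [FB lB] [FC lC].
  have u : uniq [:: A; B; X0] by rewrite /= !inE negb_or AB !bm.
  by apply: (negP (free _ _ _ FA FB FC u)); apply: sdr_large; rewrite ?card_ord ?lC // ltnW.
pose miss (i : 'I_n) := [set X in mid | i \notin X].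
have sum_miss : \sum_i #|miss i| = #|mid| * k.
  rewrite -sum_nat_const; under eq_bigr do rewrite cardI.
  rewrite exchange_big; apply: eq_bigr => X /midP [_ lX].
  have -> : \sum_i (i \notin X) = #|~: X|.
    by rewrite -sum1_card [RHS]big_mkcond; apply: eq_bigr => i _; rewrite inE; case: (i \in X).
  by rewrite cardsCs setCK card_ord; lia.
have miss2 i : #|miss i| <= 2.
  rewrite leqNgt; apply/negP => /card_gt2P [A [B [C [[bA bB bC] [AB BC CA]]]]].
  move: bA bB bC; rewrite ![_ \in miss _]inE.
  move=> /andP[/midP[FA lA] iA] /andP[/midP[FB lB] iB] /andP[/midP[FC lC] iC].
  have u : uniq [:: A; B; C] by rewrite /= !inE negb_or AB BC eq_sym CA.
  apply: (negP (free _ _ _ FA FB FC u)).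
  apply: (@sdr_middle _ i); rewrite ?card_ord //.
  by rewrite !inE !negb_or iA iB.
have [big0|/card_gt0P [A bA]] := posnP #|big|.
  have : \sum_i #|miss i| <= \sum_(i : 'I_n) 2 by apply: leq_sum.
  rewrite sum_miss sum_nat_const card_ord big0; nia.
(* When there is a large set [A], two k-sets can miss [i] only if [A :\ i] is
   one of them; so there are at most as many such [i] as k-sets. *)
pose S := [set i | 1 < #|miss i|].
have SP i : i \in S -> i \in A /\ A :\ i \in mid.
  rewrite inE => /card_gt1P [X [Y [bX bY XY]]].
  move: bX bY (bigP _ bA); rewrite ![_ \in miss _]inE.
  move=> /andP[mX iX] /andP[mY iY] [FA lA].
  move: (midP _ mX) (midP _ mY) => [FX lX] [FY lY].
  have u : uniq [:: A; X; Y] by rewrite /= !inE negb_or XY !bm.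
  have [] := @sdr_mixed _ i A X Y _ _ _ _ _ XY (free _ _ _ FA FX FY u);
    rewrite ?card_ord //.
    by rewrite inE negb_or iX.
  by move=> iA [] ->.
have cS : #|S| <= #|mid|.
  rewrite -(@card_in_imset _ _ (fun i => A :\ i) S).
    by apply/subset_leq_card/subsetP => _ /imsetP [i /SP [_ ?] ->].
  move=> i j /SP [iA _] /SP [jA _] /setP /(_ i); rewrite !inE eqxx iA andbT /=.
  by rewrite andbT => /esym/negbFE/eqP.
have : \sum_i #|miss i| <= \sum_(i : 'I_n) (1 + (i \in S)).
  by apply: leq_sum => i _; have := miss2 i; rewrite inE; case: ltnP; lia.
rewrite sum_miss big_split /= sum_nat_const card_ord -big_mkcond sum1_card.
move: #|S| #|mid| #|big| cS big1 => s m b; clear -n2k k4; nia.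
Qed.

(** * Exhaustive search for small n *)

(** Subsets are encoded as their characteristic sequences of booleans, on which
    the criterion for Berge triangles evaluates inside the kernel. *)
Definition bits (n : nat) (A : {set 'I_n}) : bitseq := [seq i \in A | i <- enum 'I_n].

Fixpoint all_bits (n : nat) : seq bitseq :=
  if n is m.+1 then
    [seq true :: x | x <- all_bits m] ++ [seq false :: x | x <- all_bits m]
  else [:: [::]].

Definition sdr_bits (x y z : bitseq) : bool :=
  let v := zip x (zip y z) in
  2 < count (fun t => [&& t.1, t.2.1 & t.2.2]) v
      + has (fun t => [&& t.1, t.2.1 & ~~ t.2.2]) v
      + has (fun t => [&& t.1, ~~ t.2.1 & t.2.2]) v
      + has (fun t => [&& ~~ t.1, t.2.1 & t.2.2]) v.

Lemma bits_inj (n : nat) : injective (@bits n).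
Proof.
move=> A B /eq_in_map AB; apply/setP => i.
by apply: AB; rewrite mem_enum.
Qed.

Lemma mem_all_bits (n : nat) (x : bitseq) : (x \in all_bits n) = (size x == n).
Proof.
elim: n x => [|n IH] [|b x] //=; rewrite mem_cat.
  by apply/negbTE; rewrite negb_or; apply/andP; split; apply/mapP => -[].
rewrite eqSS -IH; apply/orP/idP => [[] /mapP [y yn [_ ->]] //|xn].
by case: b; [left|right]; apply: map_f.
Qed.

Lemma uniq_all_bits (n : nat) : uniq (all_bits n).
Proof.
elim: n => //= n IH; rewrite cat_uniq !map_inj_uniq ?IH ?andbT /=; try by move=> x y [].
by apply/hasPn => _ /mapP [y _ ->]; apply/mapP => -[].
Qed.

Lemma count_bits3 (n : nat) (A B C : {set 'I_n}) (p : pred (bool * (bool * bool))) :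
  count p (zip (bits A) (zip (bits B) (bits C))) =
  #|[set i | p (i \in A, (i \in B, i \in C))]|.
Proof.
by rewrite /bits !zip_map count_map cardsE enumT cardE /enum_mem size_filter.
Qed.

Lemma sdr_bitsE (n : nat) (A B C : {set 'I_n}) :
  sdr_bits (bits A) (bits B) (bits C) = sdr A B C.
Proof.
rewrite /sdr_bits /sdr !has_count !count_bits3.
by congr (2 < _ + (0 < _) + (0 < _) + (0 < _)); apply: eq_card => i;
   rewrite !inE /=; do 3!case: (_ \in _).
Qed.

Lemma sum_bits (n : nat) (P : pred bitseq) (w : bitseq -> nat) :
  \sum_(A : {set 'I_n} | P (bits A)) w (bits A) = \sum_(x <- all_bits n | P x) w x.
Proof.
rewrite -(big_map (@bits n) P w) /index_enum -enumT; apply: perm_big.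
apply: uniq_perm; rewrite ?uniq_all_bits ?(map_inj_uniq (@bits_inj n)) ?enum_uniq //.
move=> x; rewrite mem_all_bits; apply/mapP/eqP => [[A _ ->]|xn].
  by rewrite size_map size_enum_ord.
exists [set i : 'I_n | nth false x i]; first by rewrite mem_enum.
apply: (@eq_from_nth _ false) => [|i]; rewrite xn; first by rewrite size_map size_enum_ord.
by move=> ltin; rewrite (nth_map (Ordinal ltin)) ?size_enum_ord // inE nth_enum_ord.
Qed.

(** Adding the elements of [l] to the free family [acc] of weight [t], in all
    possible ways, is checked to keep the weight at most [W].  Elements of
    weight 0 are skipped, which prunes the small sets.  The nested conditionals
    matter: boolean connectives would be evaluated strictly, and the pruned
    branches explored. *)
Fixpoint search (w : bitseq -> nat) (W : nat) (l acc : seq bitseq) (t : nat) : bool :=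
  if l is x :: l' then
    search w W l' acc t &&
    (if w x == 0 then true
     else if pairwise (fun y z => ~~ sdr_bits x y z) acc
     then search w W l' (x :: acc) (t + w x) else true)
  else t <= W.

(** The family under consideration is the set of sequences satisfying [P]; the
    search must follow the branch that takes exactly those elements. *)
Lemma search_sound (w : bitseq -> nat) (W : nat) (P : pred bitseq) :
  (forall x y z, P x -> P y -> P z -> uniq [:: x; y; z] -> ~~ sdr_bits x y z) ->
  forall l acc t, uniq (l ++ acc) -> all P acc -> search w W l acc t ->
  t + \sum_(x <- l | P x) w x <= W.
Proof.
move=> free; elim=> [|x l IH] acc t; first by rewrite big_nil addn0.
rewrite big_cons /= => /andP[xN u] Pacc /andP[s1 s2].
have := IH acc t u Pacc s1; case: ifP => // Px le0.
move: s2; case: eqP => [-> //|_]; case: ifP => [_ s2|/negP pair _].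
  rewrite addnA; apply: (IH (x :: acc)); rewrite //= ?Px //.
  by rewrite -cat1s uniq_catCA /= xN.
case: pair; pose Q := [pred y | P y & y != x]; have Qacc : all Q acc.
  apply/allP => y yacc; rewrite /= (allP Pacc) //=.
  by apply: contraNneq xN => <-; rewrite mem_cat yacc orbT.
move: u; rewrite cat_uniq => /and3P[_ _]; rewrite uniq_pairwise.
apply: (@sub_in_pairwise _ Q) Qacc => y z /andP[Py yx] /andP[Pz zx] /= yz.
by apply: free; rewrite //= !inE negb_or eq_sym yx eq_sym zx yz.
Qed.

Lemma search_bound (n W k : nat) (w : nat -> nat) :
  search (fun x => w (count id x)) W (all_bits n) [::] 0 ->
  colorable n C3 k -> sumn [seq w (count id x) | x <- all_bits n] <= k * W.
Proof.
move=> ok col; pose v x := w (count id x).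
rewrite sumnE big_map -(sum_bits n predT v); apply: weight_bound col => F free.
pose P x := x \in [seq bits A | A <- enum F].
have PE A : P (bits A) = (A \in F) by rewrite /P (mem_map (@bits_inj n)) mem_enum.
rewrite -(eq_bigl _ _ PE) (sum_bits n P v) -[X in X <= _]add0n.
apply: search_sound ok => //; last by rewrite cats0 uniq_all_bits.
move=> _ _ _ /mapP[A AF ->] /mapP[B BF ->] /mapP[C CF ->].
rewrite (map_inj_uniq (@bits_inj n) [:: A; B; C]) sdr_bitsE.
by move: AF BF CF; rewrite !mem_enum; apply: (iffLR (Berge_free_C3P F)).
Qed.

(** A partition into seven classes of the subsets of {0,..,4} with at least two
    elements.  Two classes consist of a pair, {2,4} or {0,3}, and the three
    3-sets containing it; in the others at most two sets have more than two
    elements, which makes room for all 16 sets of this kind. *)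
Definition classes5 : seq (seq (seq nat)) :=
  [:: [:: [:: 1; 2; 4]; [:: 0; 2; 4]; [:: 2; 3; 4]; [:: 2; 4]];
      [:: [:: 0; 1; 2; 4]; [:: 1; 2; 3]; [:: 0; 4]; [:: 1; 2]];
      [:: [:: 1; 2; 3; 4]; [:: 0; 1; 4]; [:: 2; 3]; [:: 1; 4]];
      [:: [:: 0; 1; 2; 3; 4]; [:: 0; 2; 3; 4]];
      [:: [:: 0; 1; 2; 3]; [:: 1; 3; 4]; [:: 1; 3]; [:: 0; 2]];
      [:: [:: 0; 2; 3]; [:: 0; 3; 4]; [:: 0; 1; 3]; [:: 0; 3]];
      [:: [:: 0; 1; 3; 4]; [:: 0; 1; 2]; [:: 0; 1]; [:: 3; 4]]].

(** Sets with fewer than two elements belong to no Berge triangle: they are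
    found in none of the seven classes, and the reduction modulo 7 gives them
    color 0. *)
Definition color5 (x : bitseq) : nat :=
  find (fun cl => x \in [seq [seq i \in s | i <- iota 0 5] | s <- cl]) classes5 %% 7.

Lemma color5_free : all (fun k =>
  let cl := [seq x <- all_bits 5 | color5 x == k] in
  all (fun x => all (fun y => all (fun z =>
    uniq [:: x; y; z] ==> ~~ sdr_bits x y z) cl) cl) cl) (iota 0 7).
Proof. by vm_compute. Qed.

Lemma colorable5 : colorable 5 C3 7.
Proof.
exists (fun A => inord (color5 (bits A))) => k; apply/Berge_free_C3P => A B C.
pose cl := [seq x <- all_bits 5 | color5 x == k].
have clP (X : {set 'I_5}) : X \in [set X | inord (color5 (bits X)) == k] -> bits X \in cl.
  rewrite inE mem_filter mem_all_bits size_map size_enum_ord eqxx andbT => /eqP <-.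
  by rewrite inordK ?ltn_pmod.
move=> /clP cA /clP cB /clP cC; rewrite -(map_inj_uniq (@bits_inj 5)) -sdr_bitsE.
have free := allP color5_free k.
rewrite mem_iota ltn_ord in free.
by have /implyP := allP (allP (allP (free isT) _ cA) _ cB) _ cC.
Qed.

(** A free family has at most three sets of size at least 3, and at most two if
    one of them has size at least 4.  The total weight 38 exceeds 6 * 6. *)
Lemma colorable5_ge7 (k : nat) : colorable 5 C3 k -> 7 <= k.
Proof.
pose w := nth 0 [:: 0; 0; 0; 2; 3; 3].
have ok : search (fun x => w (count id x)) 6 (all_bits 5) [::] 0 by vm_compute.
move/(search_bound ok); have -> : sumn [seq w (count id x) | x <- all_bits 5] = 38.
  by vm_compute.
lia.
Qed.

(** Two 3-sets and their common pair form a free family of half-weight 5; with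
    weights 2, 3, 4 for sizes 2, 3, 4 it has weight 8, as have the four edges of
    a 4-cycle, and the total weight 28 exceeds 3 * 8. *)
Lemma colorable4_ge4 (k : nat) : colorable 4 C3 k -> 4 <= k.
Proof.
pose w := nth 0 [:: 0; 0; 2; 3; 4].
have ok : search (fun x => w (count id x)) 8 (all_bits 4) [::] 0 by vm_compute.
move/(search_bound ok); have -> : sumn [seq w (count id x) | x <- all_bits 4] = 28.
  by vm_compute.
lia.
Qed.

Lemma colorable3_ge2 (k : nat) : colorable 3 C3 k -> 2 <= k.
Proof.
pose w := nth 0 [:: 0; 0; 2; 2].
have ok : search (fun x => w (count id x)) 4 (all_bits 3) [::] 0 by vm_compute.
move/(search_bound ok); have -> : sumn [seq w (count id x) | x <- all_bits 3] = 8.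
  by vm_compute.
lia.
Qed.

Lemma colorable6_ge16 (k : nat) : colorable 6 C3 k -> 16 <= k.
Proof.
pose w := nth 0 [:: 0; 0; 0; 1; 2; 2; 2].
have ok : search (fun x => w (count id x)) 4 (all_bits 6) [::] 0 by vm_compute.
move/(search_bound ok); have -> : sumn [seq w (count id x) | x <- all_bits 6] = 64.
  by vm_compute.
lia.
Qed.

Theorem theorem1 :
  (forall n : nat, 3 <= n -> n <> 5 -> f_is n C3 (2 ^ (n - 2)))
  /\ f_is 5 C3 7.
Proof.
split; last by split; [exact: colorable5 | exact: colorable5_ge7].
move=> n n3 n5; split=> [|k]; first by apply: colorable_pow2; lia.
have [n7|n6 col] := leqP 7 n.
  move/(weight_bound (fun F => half_weight_le4 n7)); rewrite sum_half_weight.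
  have -> : 2 ^ n = 2 ^ (n - 2) * 4 by rewrite -[4]/(2 ^ 2) -expnD subnK // ltnW.
  by rewrite leq_pmul2r.
have : [\/ n = 3, n = 4 | n = 6].
  by case: n n3 n5 n6 {col} => [|[|[|[|[|[|[|]]]]]]] //;
    [constructor 1|constructor 2|constructor 3].
by case=> E; rewrite E in col *;
   [apply: colorable3_ge2|apply: colorable4_ge4|apply: colorable6_ge16].
Qed.
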